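(* Let $G$ be a group, let $\{H_1,\dots,H_n\}$ be an admissible family of subgroups of $G$, and let $Y\subseteq G$ be equipped with an admissible decomposition $Y=\bigsqcup_{k=1}^m L_k$, $L_k=E^{(k)}_0\setminus\bigcup_{j=1}^{n_k}E^{(k)}_j$, with respect to this family. If $H_i$ is not contained in any other $H_j$ (that is, in $H_j$ for any $j\neq i$), then there is a subgroup $H$ of $G$ which contains $H_i$ as a finite-index subgroup (possibly $H=H_i$), such that $H\in\mathcal R_2(\{Y\})$, and such that $Y\in\mathcal R(\{H\}\cup\{H_j: j\neq i\})$.
   Context: A coset in $G$ is a set $sK$ with $s\in G$, $K\le G$ a subgroup. If $E'\subseteq E$ are cosets of subgroups $K'$ and $K$ respectively (so $K'\le K$), then $E'$ has infinite index in $E$ if $[K:K']=\infty$. A finite family $\{H_1,\dots,H_n\}$ of (distinct) subgroups of $G$ is called admissible if $[H_i:H_i\cap H_j]\in\{1,\infty\}$ for all $i,j$, and whenever $K$ is the intersection of some of the $H_i$, then $K$ is a finite disjoint union of cosets of some $H_k$. An admissible decomposition of a set $Y\subseteq G$ with respect to this family is an expression of $Y$ as a finite disjoint union $Y=\bigsqcup_{k=1}^m L_k$ with $L_k=E^{(k)}_0\setminus\bigcup_{j=1}^{n_k}E^{(k)}_j$, where each $E^{(k)}_j$ ($j\ge 0$) is a coset of some member of the family, and for $j\ge1$, $E^{(k)}_j\subseteq E^{(k)}_0$ with $E^{(k)}_j$ of infinite index in $E^{(k)}_0$. A relative ring of subsets is a collection of sets containing $\emptyset$ and closed under finite unions, finite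 intersections and relative complements $A\setminus B$. For a collection $\mathfrak A$ of subsets of $G$, $\mathcal R(\mathfrak A)$ is the relative ring generated by all left translates $sA$ ($A\in\mathfrak A$, $s\in G$), and $\mathcal R_2(\mathfrak A)$ is the relative ring generated by all two-sided translates $sAt$ ($A\in\mathfrak A$, $s,t\in G$).
   Formalization: Adds the hypothesis that at least one of the cosets E^{(k)}_j (0≤j≤n_k) of the given decomposition is a coset of H_i; without it the claim fails, e.g. for Y=∅ with m=0, or for G=Z², family Z×0, 0×Z, 0, with Y=Z×0 and H_i=0×Z. *)

(* Defs.v *)
From mathcomp Require Import all_boot.
From mathcomp Require Import boolp classical_sets cardinality.
From mathcomp Require Import measurable_structure.

Set Implicit Arguments.
Unset Strict Implicit.
Unset Printing Implicit Defensive.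

Local Open Scope classical_set_scope.
Local Open Scope card_scope.
Local Open Scope group_scope.

Section Cosets.
Variable G : groupType.
Implicit Types (A E K L : set G) (s t : G).

Definition subgroup K : Prop := group_closed [in K].

Definition ltranslate s A : set G := [set s * x | x in A].

Definition translate2 s A t : set G := [set s * x * t | x in A].

Definition coset_of_subgroup K E : Prop := exists s, E = ltranslate s K.

(* [K : L] is the cardinality of [left_cosets K L]; this is meant for
   subgroups L contained in K. *)
Definition left_cosets K L : set (set G) := [set ltranslate s L | s in K].

Definition index_one K L : Prop := left_cosets K L #= `I_1.
Definition finite_index K L : Prop := finite_set (left_cosets K L).
Definition infinite_index K L : Prop := infinite_set (left_cosets K L).

(* A coset determines the subgroup of which it is a left coset, so the
   existential quantification over K' and K involves no choice. *)
Definition infinite_index_coset E' E : Prop :=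
  exists K' K, [/\ subgroup K', subgroup K, coset_of_subgroup K' E',
                   coset_of_subgroup K E & infinite_index K K'].

(* Cosets are nonempty, so [trivIset] also makes the [E a] distinct. *)
Definition finite_disjoint_union_of_cosets K L : Prop :=
  exists (m : nat) (E : 'I_m -> set G),
    [/\ forall a, coset_of_subgroup L (E a),
        trivIset [set: 'I_m] E &
        K = \bigcup_(a : 'I_m) E a].

End Cosets.

Section Admissible.
Variables (G : groupType) (n : nat).
Implicit Types (H : 'I_n -> set G) (Y : set G).

Definition admissible_family H : Prop :=
  [/\ injective H,
      forall i, subgroup (H i),
      forall i j, index_one (H i) (H i `&` H j)
                  \/ infinite_index (H i) (H i `&` H j) &
      forall D : set 'I_n, D !=set0 ->
        exists k, finite_disjoint_union_of_cosets (\bigcap_(i in D) H i) (H k)].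

(* [E k j] is the coset E_j^(k); only the values with j <= nk k matter. *)
Definition piece (m : nat) (nk : 'I_m -> nat) (E : 'I_m -> nat -> set G)
    (k : 'I_m) : set G :=
  E k 0 `\` \bigcup_(j in [set j : nat | (1 <= j <= nk k)%N]) E k j.

Definition admissible_decomposition H Y (m : nat) (nk : 'I_m -> nat)
    (E : 'I_m -> nat -> set G) : Prop :=
  [/\ Y = \bigcup_(k : 'I_m) piece nk E k,
      trivIset [set: 'I_m] (piece nk E),
      forall k j, (j <= nk k)%N -> exists i, coset_of_subgroup (H i) (E k j) &
      forall k j, (1 <= j <= nk k)%N ->
        E k j `<=` E k 0 /\ infinite_index_coset (E k j) (E k 0)].

(* Needed because a decomposition with respect to a family may fail to use
   some of its members: for instance Y = set0 decomposes with m = 0. *)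
Definition occurs_in (K : set G) (m : nat) (nk : 'I_m -> nat)
    (E : 'I_m -> nat -> set G) : Prop :=
  exists k j, (j <= nk k)%N /\ coset_of_subgroup K (E k j).

End Admissible.

(* The relative rings of sets are exactly the set rings of the library, for
   which closure under intersection is a consequence. *)
Lemma setring_relative_ringP (T : Type) (C : set (set T)) :
  setring C <->
  [/\ C set0, setU_closed C, setI_closed C & setD_closed C].
Proof.
split=> [[C0 CU CD]|[C0 CU _ CD]]; split=> // A B CA CB.
by rewrite -setDD; apply: (CD) => //; apply: (CD).
Qed.

Section GeneratedRings.
Variable G : groupType.
Implicit Type AA : set (set G).

Definition ring_left AA : set (set G) :=
  <<r [set B | exists s A, AA A /\ B = ltranslate s A] >>.

Definition ring_two_sided AA : set (set G) :=
  <<r [set B | exists s t A, AA A /\ B = translate2 s A t] >>.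

End GeneratedRings.

(* Main.v *)
(* Write [B] for the maximal subgroup [H i] and [F] for the union of those [E k 0] that are cosets
   of [B].  By maximality every other coset in the decomposition belongs to some [H j] with
   [B : B `&` H j] infinite, so [Y] and [F] differ by a "thin" set, one covered by finitely many
   cosets of such subgroups.  The required subgroup is the right stabilizer [K] of [F]: it is
   {g | F g `<=` F}, a finite intersection of left translates [f^-1 F] with [f] in [F], so the
   corresponding intersection of translates of [Y] agrees with [K] up to a thin set.  B. H. Neumann's
   covering argument gives, for a thin [C], a finite subset [V] of [B] such that no left translate
   of [V] lies in [C]; a finite intersection and then a finite union of right translates by
   elements of [B] therefore remove the thin error.  Conversely [F] is a finite union of cosets of
   [K], and [Y] is recovered from it with cosets of the other [H j]; here Neumann's argument shows
   that distinct pieces involving [B] live in distinct cosets of [B]. *)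
Require Import Defs.
From mathcomp Require Import all_boot.
From mathcomp Require Import boolp classical_sets cardinality.
From mathcomp Require Import measurable_structure.

Set Implicit Arguments.
Unset Strict Implicit.
Unset Printing Implicit Defensive.

Local Open Scope classical_set_scope.

(** * Subgroups, translates and cosets *)

Lemma subgroupP (G : groupType) (K : set G) :
  subgroup K <->
  [/\ K 1%g, forall x, K x -> K (x^-1)%g & forall x y, K x -> K y -> K (x * y)%g].
Proof.
split=> [[K1 Kdiv]|[K1 KV KM]].
  have Kd x y : K x -> K y -> K (x * y^-1)%g.
    by move=> Kx Ky; apply: set_mem; apply: Kdiv; apply: mem_set.
  have KV x : K x -> K (x^-1)%g.
    by move=> Kx; rewrite -[(x^-1)%g]mul1g; apply: Kd => //; exact: set_mem.
  split=> //; first exact: set_mem.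
  by move=> x y Kx Ky; rewrite -[y]invgK; apply/Kd/KV.
split; first exact: mem_set.
by move=> x y /set_mem Kx /set_mem Ky; apply/mem_set/KM => //; exact: KV.
Qed.

Lemma ltranslateE (G : groupType) (s : G) (A : set G) :
  ltranslate s A = [set g | A (s^-1 * g)%g].
Proof.
apply/seteqP; split=> [_ [x Ax <-]|g Ag] /=; first by rewrite mulKg.
by exists (s^-1 * g)%g => //; rewrite mulVKg.
Qed.

Lemma translate2E (G : groupType) (s t : G) (A : set G) :
  translate2 s A t = [set g | A (s^-1 * g * t^-1)%g].
Proof.
apply/seteqP; split=> [_ [x Ax <-]|g Ag] /=; first by rewrite -(mulgA s) mulKg mulgK.
by exists (s^-1 * g * t^-1)%g => //; rewrite !mulgA mulgV mul1g mulgVK.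
Qed.

Lemma ltranslate_subgroup_eq (G : groupType) (K : set G) (s t : G) :
  subgroup K -> K (s^-1 * t)%g -> ltranslate s K = ltranslate t K.
Proof.
move=> /subgroupP[K1 KV KM] Kst; rewrite !ltranslateE; apply/seteqP; split=> g /= Kg.
  have -> : (t^-1 * g = (s^-1 * t)^-1 * (s^-1 * g))%g by rewrite invgM invgK mulgA mulgK.
  by apply: (KM) => //; exact: KV.
have -> : (s^-1 * g = s^-1 * t * (t^-1 * g))%g by rewrite mulgA mulgK.
exact: KM.
Qed.

Lemma coset_repr (G : groupType) (K E : set G) (g : G) :
  subgroup K -> coset_of_subgroup K E -> E g -> E = ltranslate g K.
Proof.
move=> sK [s ->]; rewrite {1}ltranslateE => /= Ks.
exact: ltranslate_subgroup_eq.
Qed.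

Lemma coset_eq (G : groupType) (K E E' : set G) (g : G) :
  subgroup K -> coset_of_subgroup K E -> coset_of_subgroup K E' ->
  E g -> E' g -> E = E'.
Proof.
move=> sK cE cE' Eg E'g.
by rewrite (coset_repr sK cE Eg) (coset_repr sK cE' E'g).
Qed.

Lemma coset_sub_subgroup (G : groupType) (K K' E E' : set G) :
  subgroup K -> subgroup K' -> coset_of_subgroup K E ->
  coset_of_subgroup K' E' -> E `<=` E' -> K `<=` K'.
Proof.
move=> /subgroupP[K1 _ _] sK' [s ->] cE' EE' x Kx.
have E's : E' s by apply: EE'; rewrite ltranslateE /= mulVg.
have : E' (s * x)%g by apply: EE'; rewrite ltranslateE /= mulKg.
by rewrite (coset_repr sK' cE' E's) ltranslateE /= mulKg.
Qed.

Lemma coset_subgroup_inj (G : groupType) (K K' E : set G) :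
  subgroup K -> subgroup K' -> coset_of_subgroup K E ->
  coset_of_subgroup K' E -> K = K'.
Proof.
by move=> sK sK' cE cE'; apply/seteqP; split;
  [apply: coset_sub_subgroup cE cE' _|apply: coset_sub_subgroup cE' cE _].
Qed.

(** * Indices and Neumann's covering argument *)

Lemma index_one_sub (G : groupType) (B K : set G) :
  subgroup B -> subgroup K -> index_one B (B `&` K) -> B `<=` K.
Proof.
move=> /subgroupP[B1 _ _] /subgroupP[K1 KV _] /card_set_bijP[f [fS finj _]] x Bx.
have cosetE y : B y -> left_cosets B (B `&` K) (ltranslate y (B `&` K)) by exists y.
have : ltranslate x (B `&` K) = ltranslate 1%g (B `&` K).
  apply: finj; rewrite ?inE; [exact: cosetE|exact: cosetE|].
  have := fS _ (cosetE _ Bx); have := fS _ (cosetE _ B1) => /=.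
  by rewrite !ltnS !leqn0 => /eqP-> /eqP->.
move=> /(congr1 (@^~ 1%g)); rewrite !ltranslateE /= invg1 !mulg1 => xE.
have [_ /KV] : B (x^-1)%g /\ K (x^-1)%g by move: xE => ->.
by rewrite invgK.
Qed.

(* [B : B `&` K] is infinite, in the form consumed by covering arguments: no finite subset of [B]
   represents all cosets of [K] meeting [B]. *)
Definition infinite_relative_index {G : groupType} (B K : set G) : Prop :=
  forall X : seq G, (forall x, x \in X -> B x) ->
  exists2 b, B b & forall x, x \in X -> ~ K (x^-1 * b)%g.

Lemma infinite_index_relative (G : groupType) (B K : set G) :
  subgroup B -> subgroup K ->
  infinite_index B (B `&` K) -> infinite_relative_index B K.
Proof.
move=> sB sK infBK X XB; apply: contrapT => noB; apply: infBK.
have sBK : subgroup (B `&` K).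
  move: sB sK => /subgroupP[B1 BV BM] /subgroupP[K1 KV KM].
  apply/subgroupP; split=> // [x [Bx Kx]|x y [Bx Kx] [By Ky]].
    by split; [exact: BV|exact: KV].
  by split; [exact: BM|exact: KM].
apply: (@sub_finite_set _ _ ((fun x => ltranslate x (B `&` K)) @` [set` X])); last first.
  exact/finite_image/finite_seq.
move=> _ [b Bb <-]; apply: contrapT => nX; apply: noB; exists b => // x xX Kxb.
apply: nX; exists x => //; apply: ltranslate_subgroup_eq => //; split=> //.
move: sB => /subgroupP[B1 BV BM]; apply: (BM) => //; exact/BV/XB.
Qed.

(* Neumann's argument: if the cosets of [K] do not cover [B], one coset of [K] inside [B] is
   covered by cosets of the remaining subgroups, hence so is every coset of [K]. *)
Lemma neumann (G : groupType) (B : set G) (Ks : seq (set G)) :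
  subgroup B ->
  (forall K, K \in Ks -> subgroup K /\ infinite_relative_index B K) ->
  forall X : seq G, (forall x, x \in X -> B x) ->
  exists2 b, B b & forall x K, x \in X -> K \in Ks -> ~ K (x^-1 * b)%g.
Proof.
move=> /[dup] sB /subgroupP[B1 BV BM].
elim: Ks => [_ X _|K Ks IH KsP X XB]; first by exists 1%g.
have [/subgroupP[K1 KV KM] infK] := KsP K (mem_head _ _).
have [h Bh Xh] := infK X XB.
(* If [b] falls into a coset [x K], it is replaced by [h * x^-1 * b], which lies in [h K]. This
   element is in [y L] exactly when [b] is in [x * h^-1 * y L], so [b] must avoid these translates
   as well. *)
pose X' := X ++ [seq (x * h^-1 * y)%g | x <- X, y <- X].
have X'B z : z \in X' -> B z.
  rewrite mem_cat => /orP[/XB//|/allpairsP[[x y] /= [xX yX ->]]].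
  by apply: (BM _ _ (BM _ _ _ _)); [exact: XB|exact: BV|exact: XB].
have {IH}[b Bb X'b] : exists2 b, B b &
    forall x L, x \in X' -> L \in Ks -> ~ L (x^-1 * b)%g.
  by apply: IH => // L LKs; apply: KsP; rewrite inE LKs orbT.
have [[x xX Kxb]|nKb] := pselect (exists2 x, x \in X & K (x^-1 * b)%g); last first.
  exists b => // x L xX; rewrite inE => /orP[/eqP->|LKs].
    by move=> Kxb; apply: nKb; exists x.
  by apply: X'b => //; rewrite mem_cat xX.
exists (h * (x^-1 * b))%g.
  by apply: (BM) => //; apply: (BM) => //; exact/BV/XB.
move=> y L yX; rewrite inE => /orP[/eqP->|LKs].
  move=> Kyhb; apply: (Xh y yX).
  have -> : (y^-1 * h = y^-1 * (h * (x^-1 * b)) * (x^-1 * b)^-1)%g.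
    by rewrite (mulgA _ h) mulgK.
  by apply: (KM) => //; exact: KV.
have -> : (y^-1 * (h * (x^-1 * b)) = (x * h^-1 * y)^-1 * b)%g.
  by rewrite !invgM invgK !mulgA.
apply: X'b => //; rewrite mem_cat; apply/orP; right.
by apply/allpairsP; exists (x, y).
Qed.

(* As [K (y * v)] means that [v] lies in the coset [y^-1 K], the count says that the elements of
   [V] lie in pairwise distinct cosets of [K]. *)
Lemma scattered (G : groupType) (B : set G) (Ks : seq (set G)) :
  subgroup B ->
  (forall K, K \in Ks -> subgroup K /\ infinite_relative_index B K) ->
  forall N, exists V : seq G, [/\ size V = N, forall v, v \in V -> B v &
    forall y K, K \in Ks -> (count (fun v => `[< K (y * v)%g >]) V <= 1)%N].
Proof.
move=> sB KsP; elim=> [|N [V [sV VB Vc]]]; first by exists [::].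
(* Greedy choice: [b] lies in no coset [v K] of an earlier [v]. *)
have [b Bb bV] := neumann sB KsP VB.
exists (b :: V); split=> [|v|y K KKs] /=; first by rewrite sV.
  by rewrite inE => /orP[/eqP->|/VB].
have [Kb|_] := asboolP; last exact: Vc.
rewrite (@eq_in_count _ _ pred0) ?count_pred0// => v vV /=.
apply/asboolPn => Kv; apply: (bV v K vV KKs).
have [/subgroupP[K1 KV KM] _] := KsP K KKs.
have -> : (v^-1 * b = (y * v)^-1 * (y * b))%g by rewrite invgM -!mulgA mulKg.
by apply: (KM) => //; exact: KV.
Qed.

Lemma count_has_le (T U : Type) (P : U -> pred T) (X : seq U) (V : seq T) :
  all (fun p => count (P p) V <= 1)%N X ->
  (count (fun v => has (P^~ v) X) V <= size X)%N.
Proof.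
elim: X => [_|p X IH /= /andP[cp cX]]; first by rewrite /= count_pred0.
apply: leq_trans (leq_add cp (IH cX)).
by rewrite -count_predUI leq_addr.
Qed.

(** * Thin sets *)

(** A pair [(s, K)] encodes the coset [s K]. Arbitrary subgroups are allowed, since right
    translation replaces [K] by a conjugate that may lie outside any given family. *)
Definition thin {G : groupType} (B C : set G) : Prop :=
  exists2 X : seq (G * set G),
    forall p, p \in X -> subgroup p.2 /\ infinite_relative_index B p.2 &
    C `<=` [set g | exists2 p, p \in X & p.2 (p.1^-1 * g)%g].

Lemma thinS (G : groupType) (B C D : set G) : C `<=` D -> thin B D -> thin B C.
Proof. by move=> CD [X XP DX]; exists X => // g /CD/DX. Qed.

Lemma thinU (G : groupType) (B C D : set G) :
  thin B C -> thin B D -> thin B (C `|` D).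
Proof.
move=> [X XP CX] [Y YP DY]; exists (X ++ Y) => [p|g].
  by rewrite mem_cat => /orP[/XP|/YP].
by move=> [/CX[p pX pg]|/DY[p pY pg]]; exists p => //; rewrite mem_cat ?pX ?pY ?orbT.
Qed.

Lemma thin0 (G : groupType) (B : set G) : thin B set0.
Proof. by exists [::]. Qed.

Lemma thin_fin_bigcup (G : groupType) (B : set G) : fin_bigcup_closed (thin B).
Proof.
apply/fin_bigcup_closedP; split; first exact: thin0.
by move=> C D; exact: thinU.
Qed.

Lemma thin_coset (G : groupType) (B K E : set G) :
  subgroup K -> infinite_relative_index B K -> coset_of_subgroup K E ->
  thin B E.
Proof.
move=> sK infK [s ->]; exists [:: (s, K)] => [p|]; first by rewrite inE => /eqP->.
by rewrite ltranslateE => g Kg; exists (s, K); rewrite ?mem_head.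
Qed.

Lemma thin_preimage_left (G : groupType) (B C : set G) (s : G) :
  thin B C -> thin B [set g | C (s * g)%g].
Proof.
move=> [X XP CX]; exists [seq ((s^-1 * p.1)%g, p.2) | p <- X] => [_ /mapP[p /XP pP ->]//|].
move=> g /= /CX[p pX pg]; exists ((s^-1 * p.1)%g, p.2) => /=; last first.
  by rewrite invgM invgK -mulgA.
by apply/mapP; exists p.
Qed.

(** The right translate [s K b^-1] is the left coset by [s * b^-1] of the conjugate [b K b^-1],
    whose relative index in [B] stays infinite because [b] lies in [B]. *)
Lemma thin_preimage_right (G : groupType) (B C : set G) (b : G) :
  subgroup B -> B b -> thin B C -> thin B [set g | C (g * b)%g].
Proof.
move=> /subgroupP[B1 BV BM] Bb [X XP CX].
exists [seq ((p.1 * b^-1)%g, [set g | p.2 (b^-1 * g * b)%g]) | p <- X].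
  move=> _ /mapP[p /XP[/subgroupP[K1 KV KM] infK] ->] /=; split.
    apply/subgroupP; split=> [|x Kx|x y Kx Ky] /=.
    - by rewrite mulg1 mulVg.
    - by have := KV _ Kx; rewrite !invgM invgK mulgA.
    - have -> : (b^-1 * (x * y) * b = (b^-1 * x * b) * (b^-1 * y * b))%g.
        by rewrite -!mulgA mulVKg.
      exact: KM.
  move=> Y YB; have [|c Bc cY] := infK [seq (y * b)%g | y <- Y].
    by move=> _ /mapP[y /YB By ->]; exact: BM.
  exists (c * b^-1)%g => [|y yY /=]; first by apply: (BM) => //; exact: BV.
  have -> : (b^-1 * (y^-1 * (c * b^-1)) * b = (y * b)^-1 * c)%g.
    by rewrite invgM !mulgA mulgVK.
  by apply: cY; apply/mapP; exists y.
move=> g /= /CX[p pX pg]; exists ((p.1 * b^-1)%g, [set g | p.2 (b^-1 * g * b)%g]).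
  by apply/mapP; exists p.
by rewrite /= invgM invgK -!mulgA mulKg.
Qed.

(** Pigeonhole: [V] has one element more than there are cosets covering [C], and each of these
    contains [y * v] for at most one [v]. *)
Lemma thin_avoid (G : groupType) (B C : set G) :
  subgroup B -> thin B C ->
  exists2 V : seq G, (forall v, v \in V -> B v) &
    forall y, exists2 v, v \in V & ~ C (y * v)%g.
Proof.
move=> sB [X XP CX].
have [|V [sV VB Vc]] := @scattered _ _ (map snd X) sB _ (size X).+1.
  by move=> _ /mapP[p /XP pP ->].
exists V => // y; apply: contrapT => nV.
pose P (p : G * set G) : pred G := fun v => `[< p.2 (p.1^-1 * y * v)%g >].
have /count_has_le : all (fun p => count (P p) V <= 1)%N X.
  by apply/allP => p pX; apply: Vc; exact: map_f.
rewrite (@eq_in_count _ _ predT) => [|v vV].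
  by rewrite count_predT sV ltnn.
rewrite /=; apply/hasP; have [/CX[p pX pv]|nC] := pselect (C (y * v)%g).
  by exists p => //; apply/asboolP; rewrite -mulgA.
by case: nV; exists v.
Qed.

(** * Set rings and the removal of thin errors *)

Lemma setring_fin_bigcupP (T : Type) (R : set (set T)) :
  setring R -> fin_bigcup_closed R.
Proof. by case=> R0 RU _; apply/fin_bigcup_closedP. Qed.

(** A set ring need not contain the whole space, so complements are taken inside [A i0]; the index
    set must therefore be nonempty. *)
Lemma setring_fin_bigcap (T : Type) (R : set (set T)) (I : choiceType)
    (D : set I) (A : I -> set T) (i0 : I) :
  setring R -> finite_set D -> D i0 -> (forall i, D i -> R (A i)) ->
  R (\bigcap_(i in D) A i).
Proof.
move=> /[dup] Rr [_ _ RD] finD Di0 RA.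
have -> : \bigcap_(i in D) A i = A i0 `\` \bigcup_(i in D) (A i0 `\` A i).
  apply/seteqP; split=> [x xA|x [xA0 nx] i Di].
    by split=> [|[i Di [_]]]; [exact: xA|apply; exact: xA].
  by apply: contrapT => nAi; apply: nx; exists i.
apply: (RD); first exact: RA.
by apply: (setring_fin_bigcupP Rr) => // i Di; apply: RD; exact: RA.
Qed.

(* Intersecting right translates by [B] removes [W `\` K]; the union of right translates of the
   result then fills in what is missing from [K]. *)
Lemma setring_thin_correction (G : groupType) (B K W : set G) (R : set (set G)) :
  subgroup B -> (forall g b, K g -> B b -> K (g * b)%g) ->
  thin B (K `\` W) -> thin B (W `\` K) -> setring R ->
  (forall b, B b -> R [set g | W (g * b)%g]) -> R K.
Proof.
move=> /[dup] sB /subgroupP[B1 BV BM] KB tKW tWK Rr RW.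
have KBE g b : B b -> K (g * b)%g -> K g.
  by move=> Bb /KB /(_ (BV _ Bb)); rewrite mulgK.
have [V VB Vav] := thin_avoid sB tWK.
(* Only nonemptiness of [V] matters here, for the finite intersections over [V]. *)
have [v0 v0V _] := Vav 1%g.
pose W1 := \bigcap_(v in [set` V]) [set g | W (g * v)%g].
have W1K : W1 `<=` K.
  move=> g W1g; apply: contrapT => nKg; have [v vV] := Vav g; apply; split.
    exact: W1g.
  by move=> /KBE Kg; apply: nKg; apply: Kg; exact: VB.
have tKW1 : thin B (K `\` W1).
  apply: (@thinS _ _ _ (\bigcup_(v in [set` V]) [set g | (K `\` W) (g * v)%g])).
    move=> g [Kg /existsNP[v /not_implyP[vV nW]]]; exists v => //; split=> //.
    by apply: KB => //; exact: VB.
  by apply: thin_fin_bigcup => [|v vV];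
    [exact: finite_seq|apply: thin_preimage_right => //; exact: VB].
have [U UB Uav] := thin_avoid sB tKW1.
have -> : K = \bigcup_(u in [set` U]) \bigcap_(v in [set` V])
    [set g | W (g * (u * v))%g].
  apply/seteqP; split=> [g Kg|g [u uU W1g]].
    have [u uU nu] := Uav g; exists u => // v vV /=; rewrite mulgA.
    by apply: contrapT => nW; apply: nu; split=> [|/(_ v vV)//]; apply: KB => //; exact: UB.
  apply: (@KBE _ u); first exact: UB.
  by apply: W1K => v vV /=; rewrite -mulgA; exact: W1g.
apply: (setring_fin_bigcupP Rr) => [|u uU]; first exact: finite_seq.
apply: (@setring_fin_bigcap _ _ _ _ _ v0) => [//||//|v vV]; first exact: finite_seq.
by apply: RW; apply: (BM); [exact: UB|exact: VB].
Qed.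

(** * The right stabilizer of a finite union of cosets *)

Definition right_stabilizer {G : groupType} (F : set G) : set G :=
  [set g | forall f, F f -> F (f * g)%g].

(** Inverses are the only difficulty. The points [f0 * x ^+ k] stay in [F], hence in finitely many
    cosets of [B]; two of them share a coset, so some positive power of [x] lies in [B], and [x^-1]
    is a power of [x] times an element of [B]. *)
Lemma right_stabilizer_subgroup (G : groupType) (B F : set G) (A : seq G) (f0 : G) :
  subgroup B -> B `<=` right_stabilizer F -> F f0 ->
  F `<=` [set g | exists2 a, a \in A & B (a^-1 * g)%g] ->
  subgroup (right_stabilizer F).
Proof.
move=> /subgroupP[B1 BV BM] BF Ff0 FA.
have M1 : right_stabilizer F 1%g by move=> f; rewrite mulg1.
have MM x y : right_stabilizer F x -> right_stabilizer F y -> right_stabilizer F (x * y)%g.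
  by move=> Mx My f /Mx /My; rewrite mulgA.
apply/subgroupP; split=> // x Mx.
have MX k : right_stabilizer F (x ^+ k)%g.
  by elim: k => [|k IH]; rewrite ?expg0// expgS; exact: MM.
have /choice[a aP] k : exists a, a \in A /\ B (a^-1 * (f0 * x ^+ k))%g.
  by have [a aA Ba] := FA _ (MX k _ Ff0); exists a.
have [k [l [kl akl]]] : exists k l, (k < l)%N /\ a k = a l.
  apply: contrapT => inj.
  suff : (size (map a (iota 0 (size A).+1)) <= size A)%N by rewrite size_map size_iota ltnn.
  apply: uniq_leq_size => [|_ /mapP[k _ ->]]; last by have [] := aP k.
  rewrite map_inj_uniq ?iota_uniq// => k l akl.
  by have [kl|kl|//] := ltngtP k l; case: inj; [exists k, l|exists l, k].
have Bx : B (x ^+ (l - k))%g.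
  have [_ Bk] := aP k; have [_ Bl] := aP l.
  have -> : (x ^+ (l - k) = ((a k)^-1 * (f0 * x ^+ k))^-1 *
      ((a k)^-1 * (f0 * x ^+ l)))%g.
    rewrite -[in RHS](subnKC (ltnW kl)) expgnDr.
    by rewrite !(mulgA _ f0) (mulgA _ (x ^+ k)%g) mulKg.
  by apply: (BM); [exact: BV|rewrite akl].
move: Bx kl; rewrite -subn_gt0; case: (l - k)%N => // j Bx _.
have -> : (x^-1 = x ^+ j * (x ^+ j.+1)^-1)%g by rewrite expgS invgM mulVKg.
apply: (MM); [exact: MX|exact/BF/BV].
Qed.

(** Stabilizing [F] depends only on the coset [g B]. Once [f0 * g] is in [F], this coset is one of
    the finitely many [f0^-1 * a B], and one test point for each of them suffices. *)
Lemma right_stabilizer_fin_bigcap (G : groupType) (B F : set G) (A : seq G) (f0 : G) :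
  subgroup B -> B `<=` right_stabilizer F -> F f0 ->
  F `<=` [set g | exists2 a, a \in A & B (a^-1 * g)%g] ->
  exists2 D : seq G, f0 \in D /\ (forall d, d \in D -> F d) &
    right_stabilizer F = \bigcap_(d in [set` D]) [set g | F (d * g)%g].
Proof.
move=> /subgroupP[B1 BV BM] BF Ff0 FA.
(* [w a] witnesses that [f0^-1 * a] does not stabilize [F]; when it does stabilize [F], the default
   is [f0]. *)
have /choice[w wP] a : exists d, F d /\
    (~ right_stabilizer F (f0^-1 * a)%g -> ~ F (d * (f0^-1 * a))%g).
  have [Ma|/existsNP[d /not_implyP[Fd nF]]] := pselect (right_stabilizer F (f0^-1 * a)%g).
    by exists f0.
  by exists d.
exists (f0 :: map w A).
  split=> [|d]; first exact: mem_head.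
  by rewrite inE => /orP[/eqP->//|/mapP[a _ ->]]; have [] := wP a.
apply/seteqP; split=> [g Mg d /=|g Dg].
  by rewrite inE => /orP[/eqP->|/mapP[a _ ->]]; apply: Mg => //; have [] := wP a.
have [a aA Ba] : exists2 a, a \in A & B (a^-1 * (f0 * g))%g.
  by apply: FA; exact: (Dg f0 (mem_head _ _)).
have Fr d c h : F (d * c)%g -> B (c^-1 * h)%g -> F (d * h)%g.
  by move=> Fdc /BF /(_ _ Fdc); rewrite -mulgA mulVKg.
have [_ wa] := wP a.
have Bag : B ((f0^-1 * a)^-1 * g)%g by rewrite invgM invgK -mulgA.
have [Ma|/wa nFw] := pselect (right_stabilizer F (f0^-1 * a)%g).
  by move=> f /Ma /Fr; apply.
case: nFw; have Fwg : F (w a * g)%g.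
  by apply: (Dg (w a)); rewrite /= inE map_f ?orbT.
by apply: (Fr _ g) => //; have := BV _ Bag; rewrite invgM invgK.
Qed.

Lemma right_stabilizer_finite_index (G : groupType) (B F : set G) (A : seq G) (f0 : G) :
  subgroup B -> F f0 -> F `<=` [set g | exists2 a, a \in A & B (a^-1 * g)%g] ->
  finite_index (right_stabilizer F) B.
Proof.
move=> sB Ff0 FA.
apply: (@sub_finite_set _ _ ((fun a => ltranslate (f0^-1 * a)%g B) @` [set` A])).
  move=> _ [s /(_ _ Ff0) /FA[a aA Ba] <-]; exists a => //.
  by apply: ltranslate_subgroup_eq => //; rewrite invgM invgK -mulgA.
exact/finite_image/finite_seq.
Qed.

Lemma right_stabilizer_ring_two_sided (G : groupType) (B F Y : set G) (A : seq G) (f0 : G) :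
  subgroup B -> B `<=` right_stabilizer F -> F f0 ->
  F `<=` [set g | exists2 a, a \in A & B (a^-1 * g)%g] ->
  thin B (F `\` Y) -> thin B (Y `\` F) ->
  ring_two_sided [set Y] (right_stabilizer F).
Proof.
move=> sB BF Ff0 FA tFY tYF.
have [D [Df0 DF] KE] := right_stabilizer_fin_bigcap sB BF Ff0 FA.
(* The formula for the stabilizer with [Y] in place of [F]: the two differ by a thin set. *)
pose W := \bigcap_(d in [set` D]) [set g | Y (d * g)%g].
apply: (@setring_thin_correction _ B _ W) => //.
- by move=> g b Mg /BF Mb f /Mg /Mb; rewrite mulgA.
- apply: (@thinS _ _ _ (\bigcup_(d in [set` D]) [set g | (F `\` Y) (d * g)%g])).
    move=> g [Mg /existsNP[d /not_implyP[dD nY]]]; exists d => //; split=> //.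
    exact/Mg/DF.
  apply: thin_fin_bigcup => [|d dD]; [exact: finite_seq|exact: thin_preimage_left].
- apply: (@thinS _ _ _ (\bigcup_(d in [set` D]) [set g | (Y `\` F) (d * g)%g])).
    rewrite KE => g [Wg /existsNP[d /not_implyP[dD nF]]]; exists d => //; split=> //.
    exact: Wg.
  apply: thin_fin_bigcup => [|d dD]; [exact: finite_seq|exact: thin_preimage_left].
- exact: smallest_setring.
- move=> b Bb.
  have -> : [set g | W (g * b)%g] = \bigcap_(d in [set` D]) translate2 (d^-1)%g Y (b^-1)%g.
    by apply/seteqP; split=> g Wg d /Wg; rewrite translate2E /= !invgK -mulgA.
  apply: (@setring_fin_bigcap _ _ _ _ _ f0) => [||//|d _].
  + exact: smallest_setring.
  + exact: finite_seq.
  + by apply: sub_setring; exists (d^-1)%g, (b^-1)%g, Y.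
Qed.

Theorem proposition3p9 (G : groupType) (n : nat) (H : 'I_n -> set G)
    (Y : set G) (m : nat) (nk : 'I_m -> nat) (E : 'I_m -> nat -> set G)
    (i : 'I_n) :
  admissible_family H ->
  admissible_decomposition H Y nk E ->
  occurs_in (H i) nk E ->
  (forall j, j <> i -> ~ (H i `<=` H j)) ->
  exists K : set G,
    [/\ subgroup K,
        H i `<=` K,
        finite_index K (H i),
        ring_two_sided [set Y] K &
        ring_left ([set K] `|` [set H j | j in [set j | j <> i]]) Y].
Proof.
move=> [Hinj sH Hidx _] [YE Ytriv Ecoset Esub] [k1 [j1 [j1le Ekj1]]] Hmax.
have sB := sH i.
have infH j : j <> i -> infinite_relative_index (H i) (H j).
  move=> ji; apply: infinite_index_relative => //.
  have [idx1|//] := Hidx i j; case: (Hmax j ji); exact: index_one_sub idx1.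
pose S := [set k | coset_of_subgroup (H i) (E k 0)].
have E0coset k : exists j, coset_of_subgroup (H j) (E k 0) by apply: Ecoset.
have E0other k : ~ S k -> exists2 j, j <> i & coset_of_subgroup (H j) (E k 0).
  by move=> nSk; have [j cj] := E0coset k; exists j => // ji; apply: nSk; rewrite /S /= -ji.
(* If a hole were a coset of [H i], maximality would make [E k 0] a coset of [H i] too, and the
   index of the hole would be one instead of infinite. *)
have Ehole k j : (1 <= j <= nk k)%N ->
    exists2 l, l <> i & coset_of_subgroup (H l) (E k j).
  move=> /[dup] jk /andP[_ jle]; have [l cl] := Ecoset k j jle; exists l => // li.
  have [l0 cl0] := E0coset k.
  rewrite {l}li in cl; have [EE [K' [K [sK' sK cK' cK infK]]]] := Esub k j jk.
  have Hil0 := coset_sub_subgroup sB (sH l0) cl cl0 EE.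
  have l0i : l0 = i by apply: contrapT => /Hmax; apply.
  rewrite {l0 Hil0}l0i in cl0.
  apply: infK; rewrite (coset_subgroup_inj sK' sB cK' cl) (coset_subgroup_inj sK sB cK cl0).
  apply: (@sub_finite_set _ _ [set H i]); last exact: finite_set1.
  move=> _ [s Hs <-] /=; apply: (coset_eq (g := s) sB) => //; first by exists s.
    by exists 1%g; apply/seteqP; split=> x; rewrite ltranslateE /= invg1 mul1g.
  by rewrite ltranslateE /= mulVg; have /subgroupP[] := sB.
have thinE k j : (exists2 l, l <> i & coset_of_subgroup (H l) (E k j)) -> thin (H i) (E k j).
  by move=> [l li cl]; exact: thin_coset (sH l) (infH l li) cl.
pose F := \bigcup_(k in S) E k 0.
pose D := \bigcup_(k in S) \bigcup_(j in [set j | (1 <= j <= nk k)%N]) E k j.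
have finI (P : set 'I_m) : finite_set P by exact: finite_finset.
have finJ k : finite_set [set j | (1 <= j <= nk k)%N].
  apply: (@sub_finite_set _ _ `I_(nk k).+1); last exact: finite_II.
  by move=> j /= /andP[].
have thinD : thin (H i) D.
  apply: thin_fin_bigcup => // k _; apply: thin_fin_bigcup => // j jk.
  exact/thinE/Ehole.
have YFD : Y = (F `\` D) `|` \bigcup_(k in ~` S) piece nk E k.
  have holesD k : S k -> \bigcup_(j in [set j | (1 <= j <= nk k)%N]) E k j `<=` D.
    by move=> Sk g Eg; exists k.
  rewrite YE; apply/seteqP; split=> [g [k _ pkg]|g]; last first.
    move=> [[[k Sk Eg] nD]|[k _ pkg]]; exists k => //; split=> //.
    by move=> /(holesD k Sk).
  have [Sk|nSk] := pselect (S k); last by right; exists k.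
  left; split; first by case: pkg; exists k.
  (* A point of piece [k] in a hole of piece [l] forces [E k 0 = E l 0]. The thin set [D] cannot
     cover this coset, so the two pieces share a point; by disjointness [k = l], and the point lies
     in a hole of its own piece. *)
  move=> [l Sl [j jl Elg]]; have [Ekg nEk] := pkg.
  have Elg0 : E l 0 g by have [EE _] := Esub l j jl; exact: EE.
  have Ekl := coset_eq sB Sk Sl Ekg Elg0.
  have [s Es] := Sk.
  have [V VB Vav] := thin_avoid sB thinD.
  have [v vV nDv] := Vav s.
  have Ekv : E k 0 (s * v)%g by rewrite Es ltranslateE /= mulKg; exact: VB.
  have kl : k = l.
    apply: Ytriv => //; exists (s * v)%g; split; split=> //.
    - by move=> /(holesD k Sk).
    - by rewrite -Ekl.
    - by move=> /(holesD l Sl).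
  by apply: nEk; exists j; rewrite kl.
have tFY : thin (H i) (F `\` Y).
  apply: (thinS _ thinD) => g [Fg]; apply: contra_notP => nD.
  by rewrite YFD; left.
have tYF : thin (H i) (Y `\` F).
  apply: (@thinS _ _ _ (\bigcup_(k in ~` S) E k 0)).
    by rewrite YFD => g [[[]|[k Sk [Eg _]]]] // _; exists k.
  by apply: thin_fin_bigcup => // k Sk; exact/thinE/E0other.
have BF : H i `<=` right_stabilizer F.
  move=> b Bb f [k Sk Ef]; exists k => //.
  by rewrite (coset_repr sB Sk Ef) ltranslateE /= mulKg.
(* The given occurrence of [H i] cannot be a hole, by [Ehole] and injectivity of [H], so it is an
   outer coset and [F] is nonempty. *)
have Sk1 : S k1.
  have [j10|j1gt0] := posnP j1; first by rewrite /S /= -j10.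
  have [l li cl] : exists2 l, l <> i & coset_of_subgroup (H l) (E k1 j1).
    by apply: Ehole; rewrite j1gt0.
  by case: li; apply: Hinj; exact: coset_subgroup_inj cl Ekj1.
have [f0 Ff0] : F !=set0.
  by have [s Es] := Sk1; exists s, k1 => //; rewrite Es ltranslateE /= mulVg;
    have /subgroupP[] := sB.
have /choice[a aP] k : exists a, S k -> E k 0 = ltranslate a (H i).
  by have [[a Ea]|nS] := pselect (S k); [exists a|exists 1%g].
have FA : F `<=` [set g | exists2 x, x \in map a (enum 'I_m) & H i (x^-1 * g)%g].
  move=> g [k Sk]; rewrite aP// ltranslateE => Hg; exists (a k) => //.
  by apply: map_f; rewrite mem_enum.
have sK := right_stabilizer_subgroup sB BF Ff0 FA.
exists (right_stabilizer F); split=> //.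
- exact: right_stabilizer_finite_index Ff0 FA.
- exact: right_stabilizer_ring_two_sided Ff0 FA tFY tYF.
have ringE k j : (exists2 l, l <> i & coset_of_subgroup (H l) (E k j)) ->
    ring_left ([set right_stabilizer F] `|` [set H j | j in [set j | j <> i]]) (E k j).
  move=> [l li [s ->]]; apply: sub_setring; exists s, (H l); split=> //.
  by right; exists l.
rewrite {}YFD; apply: setringU; last first.
  apply: setring_fin_bigcup => // k nSk; apply: setringD; first by apply: ringE; exact: E0other.
  by apply: setring_fin_bigcup => // j jk; apply: ringE; exact: Ehole.
apply: setringD; last first.
  apply: setring_fin_bigcup => // k _; apply: setring_fin_bigcup => // j jk.
  by apply: ringE; exact: Ehole.
(* Enlarging each coset of [H i] to a coset of the stabilizer does not leave [F], since [a k] itself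
   lies in [F]. *)
have FE : \bigcup_(k in S) ltranslate (a k) (right_stabilizer F) = F.
  apply/seteqP; split=> [g [k Sk]|g [k Sk Eg]]; last first.
    by exists k => //; move: Eg; rewrite aP// !ltranslateE; exact: BF.
  rewrite ltranslateE /= => Mg; rewrite -(mulVKg (a k) g); apply: Mg.
  by exists k => //; rewrite aP// ltranslateE /= mulVg; have /subgroupP[] := sB.
rewrite -[X in smallest _ _ X]FE.
apply: setring_fin_bigcup => // k _; apply: sub_setring.
by exists (a k), (right_stabilizer F); split=> //; left.
Qed.
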